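(* Let $\mathbf B$ be an involutive bisemilattice, identified with its Płonka sum representation over $\langle\{\mathbf A_i\}_{i\in I},I,p_{ij}\rangle$, with Booleanisation $\mathbf A_\infty$ and projection $\pi\colon B\to A_\infty$. There exists a bijection $\Phi\colon\mathcal S(\mathbf B)\to\mathcal S(\mathbf A_\infty)$ which is state preserving, i.e. $s(b)=\Phi(s)(\pi(b))$ for every $s\in\mathcal S(\mathbf B)$ and every $b\in B$.
   Context: An involutive bisemilattice is an algebra $\mathbf B=\langle B,\wedge,\vee,',0,1\rangle$ of type $(2,2,1,0,0)$ satisfying $x\vee x\approx x$, $x\vee y\approx y\vee x$, $x\vee(y\vee z)\approx(x\vee y)\vee z$, $(x')'\approx x$, $x\wedge y\approx(x'\vee y')'$, $x\wedge(x'\vee y)\approx x\wedge y$, $0\vee x\approx x$, $1\approx 0'$. Every involutive bisemilattice is (canonically) the Płonka sum of a semilattice direct system of Boolean algebras, and $\mathbf B$ is identified with it: there is a join-semilattice $(I,\vee)$ with least element $i_0$, Boolean algebras $\mathbf A_i$ ($i\in I$) with pairwise disjoint universes, and Boolean homomorphisms $p_{ij}\colon\mathbf A_i\to\mathbf A_j$ for $i\le j$, with $p_{ii}=\mathrm{id}$ and $p_{ik}=p_{jk}\circ p_{ij}$, such that $B=\bigsqcup_{i\in I}A_i$; for $a\in A_i$, $b\in A_j$, $k=i\vee j$, $a\wedge b=p_{ik}(a)\wedge^{\mathbf A_k}p_{jk}(b)$, $a\vee b=p_{ik}(a)\vee^{\mathbf A_k}p_{jk}(b)$; $a'$ is computed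 in the algebra containing $a$; $0,1$ are those of $\mathbf A_{i_0}$. $0_i,1_i$ denote bottom and top of $\mathbf A_i$. A state over $\mathbf B$ is a map $s\colon B\to[0,1]$ with $s(1)=1$ and $s(a\vee b)=s(a)+s(b)$ whenever $a\wedge b\in\{0_i:i\in I\}$; $\mathcal S(\mathbf B)$ is the set of states. For a Boolean algebra $\mathbf A$, $\mathcal S(\mathbf A)$ is the set of finitely additive probability measures $m\colon A\to[0,1]$ ($m(1)=1$, $m(a\vee b)=m(a)+m(b)$ when $a\wedge b=0$). The Booleanisation: for $a\in A_i$, $b\in A_j$ put $a\sim b$ iff there is $k\in I$ with $i,j\le k$ and $p_{ik}(a)=p_{jk}(b)$; $\mathbf A_\infty=B/{\sim}$ is the direct limit of the system, a Boolean algebra (operations computed on representatives), and $\pi(a)=[a]_\sim$. *)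

(* Defs.v *)
From HB Require Import structures.
From mathcomp Require Import all_boot all_order all_algebra.
From mathcomp Require Import generic_quotient boolp classical_sets functions reals.

Set Implicit Arguments.
Unset Strict Implicit.
Unset Printing Implicit Defensive.

Import Order.Theory GRing.Theory Num.Theory.

HB.mixin Record isInvBisemilattice (T : Type) := {
  bvee : T -> T -> T;
  bwedge : T -> T -> T;
  binv : T -> T;
  bzero : T;
  bone : T;
  bveexx : forall x, bvee x x = x;
  bveeC : forall x y, bvee x y = bvee y x;
  bveeA : forall x y z, bvee x (bvee y z) = bvee (bvee x y) z;
  binvK : forall x, binv (binv x) = x;
  bwedgeE : forall x y, bwedge x y = binv (bvee (binv x) (binv y));
  bwedgeK : forall x y, bwedge x (bvee (binv x) y) = bwedge x y;
  bvee0x : forall x, bvee bzero x = x;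
  boneE : bone = binv bzero
}.

#[short(type="invBisemilatticeType")]
HB.structure Definition InvBisemilattice := { T of isInvBisemilattice T }.

Declare Scope ibsl_scope.
Delimit Scope ibsl_scope with ibsl.
Notation "x \vee y" := (bvee x y) (at level 50, left associativity) : ibsl_scope.
Notation "x \wedge y" := (bwedge x y) (at level 48, left associativity) : ibsl_scope.

Local Open Scope quotient_scope.
Local Open Scope ibsl_scope.

Record ibsl_isomorphism (B C : invBisemilatticeType) (f : B -> C) : Prop := {
  ibsl_iso_bij : bijective f;
  ibsl_iso_vee : {morph f : x y / x \vee y};
  ibsl_iso_wedge : {morph f : x y / x \wedge y};
  ibsl_iso_inv : {morph f : x / binv x};
  ibsl_iso_zero : f bzero = bzero;
  ibsl_iso_one : f bone = bone
}.

Local Open Scope order_scope.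

(* MathComp's {tblmorphism _ -> _} only asks that \bot and \top be preserved. *)
Record boolean_morphism d (A : ctbDistrLatticeType d) d'
    (A' : ctbDistrLatticeType d') (f : A -> A') : Prop := {
  bmorphI : {morph f : x y / x `&` y};
  bmorphU : {morph f : x y / x `|` y};
  bmorphC : {morph f : x / ~` x};
  bmorph0 : f \bot = \bot;
  bmorph1 : f \top = \top
}.

Record boolean_system dI (I : bJoinSemilatticeType dI) dA := BooleanSystem {
  fibre :> I -> ctbDistrLatticeType dA;
  trans : forall i j, i <= j -> fibre i -> fibre j;
  trans_morphism : forall i j (ij : i <= j), boolean_morphism (trans ij);
  trans_id : forall i (ii : i <= i) a, trans ii a = a;
  trans_comp : forall i j k (ij : i <= j) (jk : j <= k) (ik : i <= k) a,
    trans ik a = trans jk (trans ij a)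
}.
Arguments trans {dI I dA} D {i j} ij _ : rename.
Arguments trans_morphism {dI I dA} D {i j} ij : rename.

Section PlonkaSum.
Context dI (I : bJoinSemilatticeType dI) dA (D : boolean_system I dA).

Definition plonka : Type := {i : I & D i}.

Implicit Types a b c : plonka.

Definition plonka_vee a b : plonka :=
  Tagged (fibre D) (trans D (leUl (tag a) (tag b)) (tagged a) `|`
            trans D (leUr (tag b) (tag a)) (tagged b)).
Definition plonka_wedge a b : plonka :=
  Tagged (fibre D) (trans D (leUl (tag a) (tag b)) (tagged a) `&`
            trans D (leUr (tag b) (tag a)) (tagged b)).
Definition plonka_inv a : plonka := Tagged (fibre D) (~` tagged a).
Definition fibre_bot (i : I) : plonka := Tagged (fibre D) (\bot : D i).
Definition fibre_top (i : I) : plonka := Tagged (fibre D) (\top : D i).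

(* Image of a in the fibre over k; junk value \bot unless tag a <= k. *)
Definition up k a : D k :=
  match Sumbool.sumbool_of_bool (tag a <= k) with
  | left h => trans D h (tagged a)
  | right _ => \bot
  end.

Lemma upE k a (h : tag a <= k) : up k a = trans D h (tagged a).
Proof.
rewrite /up; case: Sumbool.sumbool_of_bool => h'; last by rewrite h in h'.
by rewrite (bool_irrelevance h h').
Qed.

Lemma up_trans j k a (h : tag a <= j) (jk : j <= k) :
  up k a = trans D jk (up j a).
Proof. by rewrite (upE (le_trans h jk)) (upE h); apply: trans_comp. Qed.

Lemma up_vee k a b : tag a <= k -> tag b <= k ->
  up k (plonka_vee a b) = up k a `|` up k b.
Proof.
move=> ha hb; have h : tag (plonka_vee a b) <= k by rewrite leUx ha hb.
rewrite (upE h) (upE ha) (upE hb) /= (bmorphU (trans_morphism D h)).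
by rewrite -!trans_comp.
Qed.

Lemma up_wedge k a b : tag a <= k -> tag b <= k ->
  up k (plonka_wedge a b) = up k a `&` up k b.
Proof.
move=> ha hb; have h : tag (plonka_wedge a b) <= k by rewrite leUx ha hb.
rewrite (upE h) (upE ha) (upE hb) /= (bmorphI (trans_morphism D h)).
by rewrite -!trans_comp.
Qed.

Lemma up_inv k a : tag a <= k -> up k (plonka_inv a) = ~` up k a.
Proof.
move=> h; rewrite (upE h) (@upE k (plonka_inv a) h) /=.
exact: (bmorphC (trans_morphism D h)).
Qed.

Lemma up_bot i k : i <= k -> up k (fibre_bot i) = \bot.
Proof.
move=> h; rewrite (@upE k (fibre_bot i) h).
exact: (bmorph0 (trans_morphism D h)).
Qed.

Lemma up_top i k : i <= k -> up k (fibre_top i) = \top.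
Proof.
move=> h; rewrite (@upE k (fibre_top i) h).
exact: (bmorph1 (trans_morphism D h)).
Qed.

Lemma plonka_eq a b : tag a = tag b ->
  (forall k, tag a <= k -> tag b <= k -> up k a = up k b) -> a = b.
Proof.
case: a b => [i x] [j y] /= e; case: _ / e y => y /(_ i (lexx i) (lexx i)).
rewrite (@upE i (existT _ i x) (lexx i)) (@upE i (existT _ i y) (lexx i)) /=.
by rewrite !trans_id => ->.
Qed.

Let veexx a : plonka_vee a a = a.
Proof.
apply: plonka_eq => [|k _ h]; first exact: joinxx.
by rewrite up_vee // joinxx.
Qed.

Let veeC a b : plonka_vee a b = plonka_vee b a.
Proof.
apply: plonka_eq => [|k]; first exact: joinC.
by rewrite !leUx => /andP[ha hb] _; rewrite !up_vee // joinC.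
Qed.

Let veeA a b c :
  plonka_vee a (plonka_vee b c) = plonka_vee (plonka_vee a b) c.
Proof.
apply: plonka_eq => [|k]; first exact: joinA.
rewrite !leUx => /and3P[ha hb hc] _.
by rewrite !up_vee ?leUx ?ha ?hb // joinA.
Qed.

Let invK a : plonka_inv (plonka_inv a) = a.
Proof. by case: a => i x; rewrite /plonka_inv /= complK. Qed.

Let wedgeE a b :
  plonka_wedge a b = plonka_inv (plonka_vee (plonka_inv a) (plonka_inv b)).
Proof.
apply: plonka_eq => // k; rewrite leUx => /andP[ha hb] _.
rewrite up_wedge // up_inv ?leUx ?ha //.
by rewrite up_vee // !up_inv // complU !complK.
Qed.

Let wedgeK a b :
  plonka_wedge a (plonka_vee (plonka_inv a) b) = plonka_wedge a b.
Proof.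
apply: plonka_eq => [|k]; first by rewrite /= joinA joinxx.
rewrite !leUx => _ /andP[ha hb].
rewrite !up_wedge ?leUx ?ha // up_vee // up_inv //.
by rewrite meetUr meetxC join0x.
Qed.

Let vee0x a : plonka_vee (fibre_bot \bot) a = a.
Proof.
apply: plonka_eq => [|k]; first exact: join0x.
rewrite leUx => /andP[h0 ha] _.
by rewrite up_vee // up_bot // join0x.
Qed.

Let oneE : fibre_top \bot = plonka_inv (fibre_bot \bot).
Proof. by rewrite /plonka_inv /= compl0. Qed.

HB.instance Definition _ := isInvBisemilattice.Build plonka
  veexx veeC veeA invK wedgeE wedgeK vee0x oneE.

Definition limit_sim : rel plonka := fun a b =>
  `[< exists k (ik : tag a <= k) (jk : tag b <= k),
        trans D ik (tagged a) = trans D jk (tagged b) >].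

Lemma limit_simP a b : reflect
  (exists k, [/\ tag a <= k, tag b <= k & up k a = up k b]) (limit_sim a b).
Proof.
apply: (iffP (asboolP _)).
  by move=> [k [ik [jk e]]]; exists k; rewrite (upE ik) (upE jk).
by move=> [k [ik jk]]; rewrite (upE ik) (upE jk) => e; exists k, ik, jk.
Qed.

Lemma up_eq_le j k a b : tag a <= j -> tag b <= j -> j <= k ->
  up j a = up j b -> up k a = up k b.
Proof. by move=> ha hb jk e; rewrite (up_trans ha jk) (up_trans hb jk) e. Qed.

Let sim_refl : reflexive limit_sim.
Proof. by move=> a; apply/limit_simP; exists (tag a). Qed.

Let sim_sym : symmetric limit_sim.
Proof.
by move=> a b; apply/limit_simP/limit_simP => -[k [ha hb e]]; exists k.
Qed.

Let sim_trans : transitive limit_sim.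
Proof.
move=> b a c /limit_simP[j [ha hb ab]] /limit_simP[k [hb' hc bc]].
apply/limit_simP; exists (j `|` k).
have hj : j <= j `|` k := leUl j k.
have hk : k <= j `|` k := leUr k j.
split; rewrite ?(le_trans ha) ?(le_trans hc) //.
by rewrite (up_eq_le ha hb hj ab) (up_eq_le hb' hc hk bc).
Qed.

Canonical limit_equiv := EquivRel limit_sim sim_refl sim_sym sim_trans.

Definition booleanisation : Type := {eq_quot limit_equiv}.

HB.instance Definition _ := Choice.copy booleanisation {eq_quot limit_equiv}.

Definition booleanisation_pi (a : plonka) : booleanisation :=
  \pi_({eq_quot limit_equiv}) a.
Definition booleanisation_repr (x : booleanisation) : plonka :=
  repr (x : {eq_quot limit_equiv}).

Local Notation Q := booleanisation.
Local Notation pi := booleanisation_pi.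
Local Notation rep := booleanisation_repr.

Lemma booleanisation_reprK x : pi (rep x) = x.
Proof. exact: reprK. Qed.

Lemma booleanisation_piP a b : reflect
  (exists k, [/\ tag a <= k, tag b <= k & up k a = up k b]) (pi a == pi b).
Proof. by rewrite eqmodE; apply: limit_simP. Qed.

Lemma booleanisation_eq a b :
  (forall k, tag a <= k -> tag b <= k -> up k a = up k b) -> pi a = pi b.
Proof.
move=> h; apply/eqP/booleanisation_piP; exists (tag a `|` tag b).
by rewrite h ?leUl ?leUr.
Qed.

Definition limit_join (x y : Q) : Q := pi (rep x \vee rep y).
Definition limit_meet (x y : Q) : Q := pi (rep x \wedge rep y).
Definition limit_compl (x : Q) : Q := pi (binv (rep x)).
Definition limit_bot : Q := pi bzero.
Definition limit_top : Q := pi bone.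
Definition limit_le (x y : Q) : bool := limit_meet x y == x.
Definition limit_lt (x y : Q) : bool := (y != x) && limit_le x y.

Let rep_pi a : exists k,
  [/\ tag (rep (pi a)) <= k, tag a <= k & up k (rep (pi a)) = up k a].
Proof. by apply/booleanisation_piP; rewrite booleanisation_reprK. Qed.

Lemma limit_joinE a b : limit_join (pi a) (pi b) = pi (a \vee b).
Proof.
apply/eqP/booleanisation_piP.
have [j [ha ha' ea]] := rep_pi a; have [k [hb hb' eb]] := rep_pi b.
have hj : j <= j `|` k := leUl j k; have hk : k <= j `|` k := leUr k j.
have ? := le_trans ha hj; have ? := le_trans ha' hj.
have ? := le_trans hb hk; have ? := le_trans hb' hk.
exists (j `|` k); split; try by rewrite leUx; apply/andP.
by rewrite !up_vee // (up_eq_le ha ha' hj ea) (up_eq_le hb hb' hk eb).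
Qed.

Lemma limit_meetE a b : limit_meet (pi a) (pi b) = pi (a \wedge b).
Proof.
apply/eqP/booleanisation_piP.
have [j [ha ha' ea]] := rep_pi a; have [k [hb hb' eb]] := rep_pi b.
have hj : j <= j `|` k := leUl j k; have hk : k <= j `|` k := leUr k j.
have ? := le_trans ha hj; have ? := le_trans ha' hj.
have ? := le_trans hb hk; have ? := le_trans hb' hk.
exists (j `|` k); split; try by rewrite leUx; apply/andP.
by rewrite !up_wedge // (up_eq_le ha ha' hj ea) (up_eq_le hb hb' hk eb).
Qed.

Lemma limit_complE a : limit_compl (pi a) = pi (binv a).
Proof.
apply/eqP/booleanisation_piP; have [j [ha ha' ea]] := rep_pi a.
by exists j; split; rewrite // !up_inv // ea.
Qed.

Let limit_ind (P : Q -> Prop) : (forall a, P (pi a)) -> forall x, P x.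
Proof. by move=> h x; rewrite -[x]booleanisation_reprK; apply: h. Qed.

Let limitE := (limit_joinE, limit_meetE, limit_complE).

Let meetC : commutative limit_meet.
Proof.
elim/limit_ind => a; elim/limit_ind => b; rewrite !limitE.
apply: booleanisation_eq => k; rewrite !leUx => /andP[ha hb] _.
by rewrite !up_wedge // meetC.
Qed.

Let joinC : commutative limit_join.
Proof. by elim/limit_ind => a; elim/limit_ind => b; rewrite !limitE bveeC. Qed.

Let meetA : associative limit_meet.
Proof.
elim/limit_ind => a; elim/limit_ind => b; elim/limit_ind => c; rewrite !limitE.
apply: booleanisation_eq => k; rewrite !leUx => /and3P[ha hb hc] _.
by rewrite !up_wedge ?leUx ?ha ?hb // meetA.
Qed.

Let joinA : associative limit_join.
Proof.
by elim/limit_ind => a; elim/limit_ind => b; elim/limit_ind => c;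
  rewrite !limitE bveeA.
Qed.

Let joinKI (y x : Q) : limit_meet x (limit_join x y) = x.
Proof.
elim/limit_ind: x => a; elim/limit_ind: y => b; rewrite !limitE.
apply: booleanisation_eq => k; rewrite !leUx => /and3P[ha _ hb] _.
by rewrite up_wedge ?leUx ?ha // up_vee // joinKI.
Qed.

Let meetKU (y x : Q) : limit_join x (limit_meet x y) = x.
Proof.
elim/limit_ind: x => a; elim/limit_ind: y => b; rewrite !limitE.
apply: booleanisation_eq => k; rewrite !leUx => /and3P[ha _ hb] _.
by rewrite up_vee ?leUx ?ha // up_wedge // meetKU.
Qed.

Let meetUl : left_distributive limit_meet limit_join.
Proof.
elim/limit_ind => a; elim/limit_ind => b; elim/limit_ind => c; rewrite !limitE.
apply: booleanisation_eq => k; rewrite !leUx => /andP[/andP[ha hb] hc] _.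
by rewrite up_wedge ?leUx ?ha // !up_vee ?leUx ?ha ?hb // !up_wedge // meetUl.
Qed.

Let meetxx : idempotent_op limit_meet.
Proof.
elim/limit_ind => a; rewrite !limitE.
by apply: booleanisation_eq => k _ h; rewrite up_wedge // meetxx.
Qed.

Fact booleanisation_display : Order.disp_t. Proof. exact: Order.Disp tt tt. Qed.

HB.instance Definition _ :=
  Order.isMeetJoinDistrLattice.Build booleanisation_display booleanisation
    (fun _ _ => erefl) (fun _ _ => erefl) meetC joinC meetA joinA
    joinKI meetKU meetUl meetxx.

Let le0x (x : Q) : (limit_bot <= x)%O.
Proof.
elim/limit_ind: x => a; rewrite leEmeet [_ `&` _]limit_meetE; apply/eqP.
apply: booleanisation_eq => k; rewrite leUx => /andP[h0 ha] _.
by rewrite up_wedge // up_bot // meet0x.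
Qed.

Let lex1 (x : Q) : (x <= limit_top)%O.
Proof.
elim/limit_ind: x => a; rewrite leEmeet [_ `&` _]limit_meetE; apply/eqP.
apply: booleanisation_eq => k; rewrite leUx => /andP[ha h0] _.
by rewrite up_wedge // up_top // meetx1.
Qed.

HB.instance Definition _ :=
  Order.hasBottom.Build booleanisation_display booleanisation le0x.
HB.instance Definition _ :=
  Order.hasTop.Build booleanisation_display booleanisation lex1.

Let joinxC (x : Q) : x `|` limit_compl x = \top.
Proof.
elim/limit_ind: x => a; rewrite limitE [_ `|` _]limit_joinE.
apply: booleanisation_eq => k; rewrite leUx => /andP[ha _] h0.
by rewrite up_vee // up_inv // up_top // joinxC.
Qed.

Let meetxC (x : Q) : x `&` limit_compl x = \bot.
Proof.
elim/limit_ind: x => a; rewrite limitE [_ `&` _]limit_meetE.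
apply: booleanisation_eq => k; rewrite leUx => /andP[ha _] h0.
by rewrite up_wedge // up_inv // up_bot // meetxC.
Qed.

HB.instance Definition _ :=
  Order.TBDistrLattice_hasComplement.Build booleanisation_display booleanisation
    joinxC meetxC.

End PlonkaSum.

Section Representation.
Variable B : invBisemilatticeType.
Implicit Types a b c e f : B.

Local Notation "0" := (bzero : B).
Local Notation "a ^-" := (binv a) (at level 2, left associativity, format "a ^-").

Let bvee0 a : a \vee 0 = a. Proof. by rewrite bveeC bvee0x. Qed.

Let binvU a b : (a \vee b)^- = a^- \wedge b^-.
Proof. by rewrite bwedgeE !binvK. Qed.

Let binvI a b : (a \wedge b)^- = a^- \vee b^-.
Proof. by rewrite bwedgeE !binvK. Qed.

Let bwedgexx a : a \wedge a = a.
Proof. by rewrite bwedgeE bveexx binvK. Qed.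

Let bwedgeC a b : a \wedge b = b \wedge a.
Proof. by rewrite !bwedgeE bveeC. Qed.

Let bwedgeA a b c : a \wedge (b \wedge c) = a \wedge b \wedge c.
Proof. by rewrite !bwedgeE !binvK bveeA. Qed.

Let bveeCA a b c : a \vee (b \vee c) = b \vee (a \vee c).
Proof. by rewrite !bveeA [a \vee b]bveeC. Qed.

Let bveeACA a b c d : (a \vee b) \vee (c \vee d) = (a \vee c) \vee (b \vee d).
Proof. by rewrite -!bveeA [b \vee (c \vee d)]bveeCA. Qed.

Let bwedgeCA a b c : a \wedge (b \wedge c) = b \wedge (a \wedge c).
Proof. by rewrite !bwedgeA [a \wedge b]bwedgeC. Qed.

Let bveeK a b : a \vee (a^- \wedge b) = a \vee b.
Proof.
have := bwedgeK a^- b^-; rewrite binvK => /(congr1 (@binv B)).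
by rewrite !binvI binvU !binvK.
Qed.

(* z a is the bottom 0_i of the fibre containing a. *)
Let z a := a \wedge 0.

Let zE a : a \wedge a^- = z a.
Proof. by rewrite /z -(bwedgeK a 0) bvee0. Qed.

Let z_inv a : z a^- = z a.
Proof. by rewrite -!zE binvK bwedgeC. Qed.

Let z_le a : a \vee z a = a.
Proof. by rewrite -z_inv bveeK bvee0. Qed.

Let zI a b : z (a \wedge b) = z a \wedge z b.
Proof.
rewrite /z -!bwedgeA; congr bwedge.
by rewrite bwedgeCA bwedgexx.
Qed.

Let zz a : z (z a) = z a. Proof. by rewrite /z -bwedgeA bwedgexx. Qed.

Let z0 : z 0 = 0. Proof. exact: bwedgexx. Qed.

Let zU' a b : z (a \vee b) = z a \wedge z b.
Proof. by rewrite -z_inv binvU zI !z_inv. Qed.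

Let zw a b : z a \wedge b = z (a \wedge b).
Proof. by rewrite /z -!bwedgeA [0 \wedge b]bwedgeC. Qed.

Let zwUI e f : z e = e -> z f = f -> e \wedge f = e \vee f.
Proof.
move=> ze zf; set g := e \wedge f.
have gz : z g = g by rewrite zI ze zf.
have e1 : g^- \wedge e = g.
  by rewrite bwedgeC -{1}ze zw zI z_inv gz ze /g bwedgeA bwedgexx.
have eg : g \vee e = g by rewrite -(bveeK g e) e1 bveexx.
have f1 : g^- \wedge f = g.
  by rewrite bwedgeC -{1}zf zw zI z_inv gz zf /g bwedgeCA bwedgexx.
have fg : g \vee f = g by rewrite -(bveeK g f) f1 bveexx.
suff: e \vee f = e \vee g by rewrite [e \vee g]bveeC eg.
rewrite -(bveeK e f); congr bvee.
by rewrite bwedgeC -{1}zf zw zI z_inv ze zf bwedgeC.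
Qed.

Let zU a b : z (a \vee b) = z a \vee z b.
Proof. by rewrite zU' zwUI // zz. Qed.

Let zIU a b : z (a \wedge b) = z a \vee z b.
Proof. by rewrite zI zwUI // zz. Qed.

Definition bottoms : Type := {e : B | e \wedge bzero = e}.

Let bottoms_eq (x y : bottoms) : sval x = sval y -> x = y.
Proof.
case: x y => [a ha] [b hb] /= e; case: _ / e hb => hb.
by rewrite (Prop_irrelevance ha hb).
Qed.

HB.instance Definition _ := gen_eqMixin bottoms.
HB.instance Definition _ := gen_choiceMixin bottoms.

Definition bottoms_le (x y : bottoms) : bool := `[< sval x \vee sval y = sval y >].

Let le_refl : reflexive bottoms_le.
Proof. by move=> x; apply/asboolP; rewrite bveexx. Qed.

Let le_anti : antisymmetric bottoms_le.
Proof.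
move=> x y /andP[/asboolP xy /asboolP yx]; apply: bottoms_eq.
by rewrite -xy bveeC.
Qed.

Let le_trans : transitive bottoms_le.
Proof.
move=> y x w /asboolP xy /asboolP yw; apply/asboolP.
by rewrite -yw bveeA xy.
Qed.

Fact bottoms_display : Order.disp_t. Proof. exact: Order.Disp tt tt. Qed.

HB.instance Definition _ :=
  Order.Le_isPOrder.Build bottoms_display bottoms le_refl le_anti le_trans.

Let join_subproof (x y : bottoms) : (sval x \vee sval y) \wedge 0 = sval x \vee sval y.
Proof.
by case: x y => [e he] [f hf] /=; rewrite -[LHS]/(z _) zU /z he hf.
Qed.

Definition bottoms_join (x y : bottoms) : bottoms := exist _ _ (join_subproof x y).

Let leUx (x y w : bottoms) : (bottoms_join x y <= w) = (x <= w) && (y <= w).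
Proof.
apply/asboolP/andP => /=.
  move=> h; split; apply/asboolP; rewrite -h.
    by rewrite !bveeA bveexx.
  by rewrite -!bveeA bveeCA [sval y \vee (sval y \vee _)]bveeA bveexx.
by move=> [/asboolP xw /asboolP yw]; rewrite -bveeA yw xw.
Qed.

HB.instance Definition _ :=
  Order.POrder_isJoinSemilattice.Build bottoms_display bottoms leUx.

Definition bottoms_zero : bottoms := exist _ 0 z0.

Let le0x (x : bottoms) : bottoms_zero <= x.
Proof. by apply/asboolP => /=; rewrite bvee0x. Qed.

HB.instance Definition _ :=
  Order.hasBottom.Build bottoms_display bottoms le0x.

Section Fibre.
Variable i : bottoms.

Definition bottom_fibre : Type := {a : B | a \wedge bzero = sval i}.
Local Notation F := bottom_fibre.

Let fib_eq (x y : F) : sval x = sval y -> x = y.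
Proof.
case: x y => [a ha] [b hb] /= e; case: _ / e hb => hb.
by rewrite (Prop_irrelevance ha hb).
Qed.

HB.instance Definition _ := gen_eqMixin F.
HB.instance Definition _ := gen_choiceMixin F.

Let ii : sval i \vee sval i = sval i. Proof. exact: bveexx. Qed.
Let zi : z (sval i) = sval i. Proof. exact: (svalP i). Qed.

Let fvee_subproof (x y : F) : z (sval x \vee sval y) = sval i.
Proof. by case: x y => [a ha] [b hb] /=; rewrite zU /z ha hb ii. Qed.
Let fwedge_subproof (x y : F) : z (sval x \wedge sval y) = sval i.
Proof. by case: x y => [a ha] [b hb] /=; rewrite zIU /z ha hb ii. Qed.
Let finv_subproof (x : F) : z (sval x)^- = sval i.
Proof. by case: x => [a ha] /=; rewrite z_inv. Qed.
Let ftop_subproof : z (sval i)^- = sval i.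
Proof. by rewrite z_inv. Qed.

Definition bfibre_join (x y : F) : F := exist _ _ (fvee_subproof x y).
Definition bfibre_meet (x y : F) : F := exist _ _ (fwedge_subproof x y).
Definition bfibre_compl (x : F) : F := exist _ _ (finv_subproof x).
Definition bfibre_bot : F := exist _ (sval i) zi.
Definition bfibre_top : F := exist _ (sval i)^- ftop_subproof.

Let absU a b : z a = z b -> a \vee (a \wedge b) = a.
Proof.
move=> e; rewrite -bveeK bwedgeA [_ \wedge a]bwedgeC zE zw zIU -e bveexx.
exact: z_le.
Qed.

Let absI a b : z a = z b -> a \wedge (a \vee b) = a.
Proof.
move=> e; rewrite bwedgeE [(a \vee b)^-]binvU absU ?binvK //.
by rewrite !z_inv.
Qed.

Let zF (x : F) : z (sval x) = sval i. Proof. exact: svalP x. Qed.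

Let meetC : commutative bfibre_meet.
Proof. by move=> x y; apply: fib_eq; apply: bwedgeC. Qed.
Let joinC : commutative bfibre_join.
Proof. by move=> x y; apply: fib_eq; apply: bveeC. Qed.
Let meetA : associative bfibre_meet.
Proof. by move=> x y w; apply: fib_eq; apply: bwedgeA. Qed.
Let joinA : associative bfibre_join.
Proof. by move=> x y w; apply: fib_eq; apply: bveeA. Qed.
Let joinKI (y x : F) : bfibre_meet x (bfibre_join x y) = x.
Proof. by apply: fib_eq; apply: absI; rewrite !zF. Qed.
Let meetKU (y x : F) : bfibre_join x (bfibre_meet x y) = x.
Proof. by apply: fib_eq; apply: absU; rewrite !zF. Qed.
Let meetxx : idempotent_op bfibre_meet.
Proof. by move=> x; apply: fib_eq; apply: bwedgexx. Qed.

Let leU a b c : b \vee a = a -> c \vee a = a -> (b \vee c) \vee a = a.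
Proof. by move=> ba ca; rewrite -bveeA ca. Qed.

Let meetUl : left_distributive bfibre_meet bfibre_join.
Proof.
move=> y w x; apply: fib_eq => /=.
case: x y w => [a ha] [b hb] [c hc] /=; rewrite -!/(z _) in ha hb hc.
rewrite [LHS]bwedgeC [b \wedge a]bwedgeC [c \wedge a]bwedgeC.
rewrite -bwedgeK.
have -> : a^- \vee (b \vee c) = a^- \vee ((a \wedge b) \vee (a \wedge c)).
  have h x : a^- \vee (a \wedge x) = a^- \vee x by rewrite -{2}[a]binvK bveeK.
  by rewrite bveeA -(h b) -bveeA bveeCA -(h c) bveeCA.
rewrite bwedgeK; set w := (_ \vee _).
have wa : w \vee a = a.
  by apply: leU; rewrite bveeC absU // ha.
by rewrite -{1}wa bwedgeC absI // /w zU !zIU ha hb hc !bveexx.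
Qed.

Fact bottom_fibre_display : Order.disp_t. Proof. exact: Order.Disp tt tt. Qed.

HB.instance Definition _ :=
  Order.isMeetJoinDistrLattice.Build bottom_fibre_display F
    (fun _ _ => erefl) (fun _ _ => erefl) meetC joinC meetA joinA
    joinKI meetKU meetUl meetxx.

Let f0x (x : F) : (bfibre_bot <= x)%O.
Proof.
rewrite leEmeet; apply/eqP; apply: fib_eq => /=.
by rewrite -{1}zi zw zIU zi zF bveexx.
Qed.

Let fx1 (x : F) : (x <= bfibre_top)%O.
Proof.
rewrite leEjoin; apply/eqP; apply: fib_eq => /=.
rewrite -[LHS]binvK binvU binvK bwedgeC -{1}zi zw zIU zi z_inv zF.
by rewrite bveexx.
Qed.

HB.instance Definition _ := Order.hasBottom.Build bottom_fibre_display F f0x.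
HB.instance Definition _ := Order.hasTop.Build bottom_fibre_display F fx1.

Let joinxC (x : F) : x `|` bfibre_compl x = \top.
Proof.
apply: fib_eq => /=; rewrite -[LHS]binvK binvU binvK bwedgeC zE.
by rewrite zF.
Qed.

Let meetxC (x : F) : x `&` bfibre_compl x = \bot.
Proof. by apply: fib_eq => /=; rewrite zE zF. Qed.

HB.instance Definition _ :=
  Order.TBDistrLattice_hasComplement.Build bottom_fibre_display F joinxC meetxC.

End Fibre.

Let fibre_eq i (x y : bottom_fibre i) : sval x = sval y -> x = y.
Proof.
case: x y => [a ha] [b hb] /= e; case: _ / e hb => hb.
by rewrite (Prop_irrelevance ha hb).
Qed.

Let trans_subproof (i j : bottoms) (ij : i <= j) (x : bottom_fibre i) :
  z (sval x \vee sval j) = sval j.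
Proof.
rewrite zU; have -> : z (sval x) = sval i := svalP x.
have -> : z (sval j) = sval j := svalP j.
exact: (asboolP _ ij).
Qed.

Definition bottom_trans (i j : bottoms) (ij : i <= j) (x : bottom_fibre i) :
  bottom_fibre j := exist _ _ (trans_subproof ij x).

Let trans_inv a e f : z a = e -> z f = f -> e \vee f = f ->
  (a \vee f)^- = a^- \vee f.
Proof.
move=> za zf ef; rewrite binvU bwedgeC bveeC.
rewrite -(bveeK f) bveeC -{1}[f^- \wedge a^-]z_le; congr bvee.
by rewrite zIU !z_inv zf za bveeC.
Qed.

Let trans_bmorph (i j : bottoms) (ij : i <= j) :
  boolean_morphism (bottom_trans ij).
Proof.
have h : sval i \vee sval j = sval j := asboolP _ ij.
have zj : z (sval j) = sval j := svalP j.
have zi : z (sval i) = sval i := svalP i.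
have zF (x : bottom_fibre i) : z (sval x) = sval i := svalP x.
have C x : bottom_trans ij (~` x) = ~` (bottom_trans ij x).
  by apply: fibre_eq; symmetry; apply: (trans_inv (zF x) zj h).
have U x y : bottom_trans ij (x `|` y) = bottom_trans ij x `|` bottom_trans ij y.
  by apply: fibre_eq => /=; rewrite bveeACA bveexx.
have Z : bottom_trans ij \bot = \bot by apply: fibre_eq.
split=> //.
- by move=> x y; rewrite -[x `&` y]complK complI C U !C -complI complK.
- by rewrite -compl0 C Z compl0.
Qed.

Let trans_id' (i : bottoms) (ii : i <= i) (x : bottom_fibre i) :
  bottom_trans ii x = x.
Proof.
apply: fibre_eq => /=; have e : z (sval x) = sval i := svalP x.
by have := z_le (sval x); rewrite e.
Qed.

Let trans_comp' (i j k : bottoms) (ij : i <= j) (jk : j <= k) (ik : i <= k)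
  (x : bottom_fibre i) : bottom_trans ik x = bottom_trans jk (bottom_trans ij x).
Proof. by apply: fibre_eq => /=; rewrite -bveeA (asboolP _ jk). Qed.

Definition canonical_system : boolean_system bottoms bottom_fibre_display :=
  BooleanSystem trans_bmorph trans_id' trans_comp'.

Definition bottom_of (a : B) : bottoms := exist _ (z a) (zz a).

Definition canonical_rho (a : B) : plonka canonical_system :=
  Tagged (fibre canonical_system) (exist _ a erefl : bottom_fibre (bottom_of a)).

Let rho_eq (x y : plonka canonical_system) :
  sval (tagged x) = sval (tagged y) -> x = y.
Proof.
case: x y => [i [a ha]] [j [b hb]] /= e; move: b e hb => _ <- hb.
have ij : i = j by apply: bottoms_eq; rewrite -ha.
by case: _ / ij hb => hb; congr existT; apply: fibre_eq.
Qed.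

Lemma canonical_rho_iso : ibsl_isomorphism canonical_rho.
Proof.
have V : {morph canonical_rho : x y / x \vee y}.
  move=> a b; apply: rho_eq => /=.
  transitivity ((a \vee b) \vee (z a \vee z b)); first by rewrite -zU z_le.
  by rewrite [RHS]bveeACA bveexx.
have N : {morph canonical_rho : x / binv x} by move=> a; apply: rho_eq.
have Z : canonical_rho bzero = bzero by apply: rho_eq.
split=> //.
- exists (fun x : plonka canonical_system =>
    sval (tagged x : bottom_fibre (tag x))) => // x; exact: rho_eq.
- by move=> a b; rewrite !bwedgeE N V !N.
- by rewrite !boneE N Z.
Qed.

End Representation.

Lemma plonka_representation (B : invBisemilatticeType) :
  exists dI (I : bJoinSemilatticeType dI) dA (D : boolean_system I dA)
    (rho : B -> plonka D), ibsl_isomorphism rho.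
Proof.
by do 4 eexists; exists (@canonical_rho B); apply: canonical_rho_iso.
Qed.

Section States.
Variable R : realType.
Local Open Scope classical_set_scope.
Local Open Scope ring_scope.

(* B is identified with the Plonka sum of D along rho, so that the elements
   0_i of B are the b with rho b = fibre_bot D i. *)
Definition states (B : invBisemilatticeType) dI (I : bJoinSemilatticeType dI) dA
    (D : boolean_system I dA) (rho : B -> plonka D) : set (B -> R) :=
  [set s | [/\ forall b, 0 <= s b <= 1,
               s bone = 1 &
               forall a b : B, (exists i, rho (a \wedge b) = fibre_bot D i) ->
                 s (a \vee b) = s a + s b]].

Definition boolean_states d (A : ctbDistrLatticeType d) : set (A -> R) :=
  [set m | [/\ forall a, 0 <= m a <= 1,
               m \top%O = 1 &
               forall a b : A, (a `&` b)%O = \bot%O ->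
                 m (a `|` b)%O = m a + m b]].

End States.

Arguments states R {B dI I dA D} rho _ : rename.
Arguments boolean_states R {d} A _ : rename.

(* Main.v *)
Require Import Defs.
From mathcomp Require Import all_boot all_order all_algebra.
From mathcomp Require Import boolp classical_sets functions reals.

(** A state vanishes on every [0_i], hence [s (a \vee 0_k) = s a]: moving an
    element up along the system does not change its value, so [s] factors
    through the Booleanisation.  Conversely a finitely additive probability
    on the Booleanisation pulls back to a state along the projection, and the
    two constructions are mutually inverse because the projection is onto. *)

Set Implicit Arguments.
Unset Strict Implicit.
Unset Printing Implicit Defensive.

Import Order.Theory GRing.Theory Num.Theory.
Local Open Scope ring_scope.
Local Open Scope ibsl_scope.

Section PlonkaStates.
Variables (R : realType) (dI dA : Order.disp_t) (I : bJoinSemilatticeType dI).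
Variable D : boolean_system I dA.
Implicit Types (a b : plonka D) (s : plonka D -> R).

Local Notation pi := (@booleanisation_pi _ I _ D).
Local Notation rep := (@booleanisation_repr _ I _ D).
Local Notation plonka_states := (states R (@id (plonka D))).

(** Transition maps preserve bottoms, so this meet is again a fibre bottom; hence additivity of a
    state applies to any [a] paired with any [fibre_bot D i]. *)
Lemma fibre_bot_wedge a i :
  a \wedge fibre_bot D i = fibre_bot D (Order.join (tag a) i).
Proof.
apply: plonka_eq => // k; rewrite leUx => /andP[ha hi] _.
by rewrite up_wedge // !up_bot ?leUx ?ha // meetx0.
Qed.

Lemma up_up a k l (ak : (tag a <= k)%O) (kl : (k <= l)%O) :
  up l (Tagged (fibre D) (up k a)) = up l a.
Proof.
by rewrite (up_trans ak kl) (@upE _ _ _ _ l (Tagged (fibre D) (up k a)) kl).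
Qed.

(** Expresses transition along the system as a join, the operation that additivity of a state
    controls. *)
Lemma vee_fibre_bot a k (ak : (tag a <= k)%O) :
  a \vee fibre_bot D k = Tagged (fibre D) (up k a).
Proof.
apply: plonka_eq => [|l]; first exact: join_r.
rewrite leUx => /andP[al kl] _.
by rewrite up_vee // up_bot // joinx0 up_up.
Qed.

(** Transition maps may fail to be injective, so an element of class [\bot] may become a fibre
    bottom only further up. *)
Lemma pi_eq_bot a :
  pi a = \bot%O <-> exists2 k, (tag a <= k)%O & up k a = \bot%O.
Proof.
split=> [/eqP/booleanisation_piP[k [ak zk e]]|[k ak e]].
  by exists k; rewrite // e up_bot.
by apply/eqP/booleanisation_piP; exists k; rewrite e up_bot ?le0x.
Qed.

Lemma state_fibre_bot s i : plonka_states s -> s (fibre_bot D i) = 0.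
Proof.
(* Additivity at the pair of [fibre_bot D i] with itself: a value equal to its own double is
   zero. *)
case=> _ _ sD; apply: (addrI (s (fibre_bot D i))); rewrite addr0.
rewrite -sD; first by rewrite bveexx.
by exists (Order.join i i); exact: fibre_bot_wedge.
Qed.

Lemma state_up s a k : plonka_states s -> (tag a <= k)%O ->
  s (Tagged (fibre D) (up k a)) = s a.
Proof.
move=> sS ak; rewrite -vee_fibre_bot //; case: (sS) => _ _ ->.
  by rewrite state_fibre_bot // addr0.
by exists (Order.join (tag a) k); exact: fibre_bot_wedge.
Qed.

Lemma state_pi s a b : plonka_states s -> pi a = pi b -> s a = s b.
Proof.
move=> sS /eqP/booleanisation_piP[k [ak bk e]].
by rewrite -(state_up sS ak) e state_up.
Qed.

Lemma state_rep_pi s a : plonka_states s -> s (rep (pi a)) = s a.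
Proof. by move=> sS; apply: state_pi => //; rewrite booleanisation_reprK. Qed.

(** The meet itself need not be a fibre bottom. Moving [a] and [b] to a fibre where it has collapsed
    makes the additivity axiom applicable, and changes neither their values nor the class of their
    join. *)
Lemma state_additive s a b : plonka_states s ->
  pi (a \wedge b) = \bot%O -> s (a \vee b) = s a + s b.
Proof.
move=> sS /pi_eq_bot[k abk e].
have /andP[ak bk] : (tag a <= k)%O && (tag b <= k)%O by rewrite -leUx.
rewrite -(state_up sS ak) -(state_up sS bk).
case: (sS) => _ _ <-.
  apply: state_pi => //; apply: booleanisation_eq => l.
  rewrite !leUx => /andP[al bl] /andP[kl _].
  by rewrite !up_vee // !up_up.
exists k; apply: plonka_eq => [|l]; first exact: joinxx.
rewrite leUx => /andP[kl _] _; rewrite up_wedge // !up_up // up_bot //.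
rewrite -up_wedge ?(le_trans _ kl) // (up_trans abk kl) e.
exact: (bmorph0 (trans_morphism D kl)).
Qed.

Lemma boolean_state_rep s : plonka_states s ->
  boolean_states R (booleanisation D) (s \o rep).
Proof.
move=> sS; case: (sS) => s01 s1 _; split=> /= [x||x y xy].
- exact: s01.
- by rewrite -s1; exact: (state_rep_pi bone).
- rewrite [Order.join x y]/(limit_join x y) state_rep_pi //.
  exact: state_additive.
Qed.

Lemma state_comp_pi (m : booleanisation D -> R) :
  boolean_states R (booleanisation D) m -> plonka_states (m \o pi).
Proof.
case=> m01 m1 mD; split=> /= [a||a b [i abi]]; [exact: m01|exact: m1|].
rewrite -limit_joinE; apply: mD; rewrite [LHS]limit_meetE abi.
by apply/pi_eq_bot; exists i; rewrite ?up_bot.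
Qed.

End PlonkaStates.

Section Transport.
Variables (R : realType) (B : invBisemilatticeType).
Variables (dI dA : Order.disp_t) (I : bJoinSemilatticeType dI).
Variables (D : boolean_system I dA) (rho : B -> plonka D).
Hypothesis rho_iso : ibsl_isomorphism rho.

Lemma states_comp_iso (t : plonka D -> R) :
  states R (@id (plonka D)) t -> states R rho (t \o rho).
Proof.
case=> t01 t1 tD; split=> /= [b||a b [i abi]].
- exact: t01.
- by rewrite (ibsl_iso_one rho_iso).
- rewrite (ibsl_iso_vee rho_iso); apply: tD.
  by exists i; rewrite -(ibsl_iso_wedge rho_iso).
Qed.

Lemma states_comp_inv (g : plonka D -> B) (s : B -> R) :
  cancel rho g -> cancel g rho ->
  states R rho s -> states R (@id (plonka D)) (s \o g).
Proof.
move=> rhoK gK [s01 s1 sD]; split=> /= [b||a b [i abi]].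
- exact: s01.
- by rewrite -(ibsl_iso_one rho_iso) rhoK.
- have -> : g (a \vee b) = g a \vee g b.
    by apply: (can_inj rhoK); rewrite (ibsl_iso_vee rho_iso) !gK.
  by apply: sD; exists i; rewrite (ibsl_iso_wedge rho_iso) !gK.
Qed.

End Transport.

Theorem theorem3p6 (R : realType) (B : invBisemilatticeType)
    (dI dA : Order.disp_t) (I : bJoinSemilatticeType dI)
    (D : boolean_system I dA) (rho : B -> plonka D)
    (rho_iso : ibsl_isomorphism rho) :
  exists Phi : (B -> R) -> (booleanisation D -> R),
    set_bij (states R rho) (boolean_states R (booleanisation D)) Phi /\
    (forall s : B -> R, states R rho s ->
       forall b : B, s b = Phi s (booleanisation_pi (rho b))).
Proof.
have [g rhoK gK] := ibsl_iso_bij rho_iso.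
(* Defined on all functions by choosing representatives; for a state the value does not depend on
   that choice. *)
pose Phi (s : B -> R) := s \o g \o @booleanisation_repr _ I _ D.
have PhiE s : states R rho s ->
    forall b, s b = Phi s (booleanisation_pi (rho b)).
  move=> /(states_comp_inv rho_iso rhoK gK) sS b.
  by rewrite /Phi /= [RHS](state_rep_pi (rho b) sS) /= rhoK.
exists Phi; split=> //; split.
- by move=> s /(states_comp_inv rho_iso rhoK gK)/boolean_state_rep.
(* Injectivity: [PhiE] recovers a state from its image. *)
- move=> s t /set_mem sS /set_mem tS e; apply: funext => b.
  by rewrite (PhiE s) // (PhiE t) // e.
(* The preimage is the pullback of [m]; [rho] undoes [g], and the projection undoes the choice of
   representatives. *)
- move=> m mS; exists (m \o @booleanisation_pi _ I _ D \o rho).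
    exact: states_comp_iso (state_comp_pi mS).
  apply: funext => x; rewrite /Phi /= gK.
  by rewrite booleanisation_reprK.
Qed.
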